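(* Let $G$ be a finite simple bipartite graph with $d$ vertices, and let $P=P(G)\subset\mathbb{R}^d$ be its graph polytope. Then the $h^*$-polynomial of $P$ is a palindromic polynomial of degree $d-2$.
   Context: For a finite simple graph $G$ with vertex set $\{1,\dots,d\}$ ($d$ a positive integer) and edge set $EG$, the graph polytope of $G$ is $$P(G)=\{(x_1,\dots,x_d)\in[0,1]^d : x_i+x_j\le 1 \text{ whenever } ij\in EG\}.$$ When $G$ is bipartite, $P(G)$ is a $d$-dimensional convex polytope all of whose vertices lie in $\mathbb{Z}^d$. For a $d$-dimensional convex polytope $P\subset\mathbb{R}^d$ with vertices in $\mathbb{Z}^d$, let $L_P(t)=|tP\cap\mathbb{Z}^d|$ for integers $t\ge 1$, and let the Ehrhart series be $\mathrm{Ehr}_P(z)=1+\sum_{t\ge 1}L_P(t)z^t$. The $h^*$-polynomial of $P$ is the polynomial $h(z)$ (of degree at most $d$) with $\mathrm{Ehr}_P(z)=\dfrac{h(z)}{(1-z)^{d+1}}$. A polynomial $p(z)$ of degree $n$ is palindromic if $z^n p(1/z)=p(z)$.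
   Formalization: The graph G is additionally assumed to have no isolated vertex; with an isolated vertex the claim always fails (e.g. two isolated vertices give h* = 1+z, and one edge plus an isolated vertex gives h* = 1+2z). *)

(* Defs.v *)
From mathcomp Require Import all_boot all_order all_algebra.
From mathcomp Require Import finmap boolp classical_sets cardinality reals.

Set Implicit Arguments.
Unset Strict Implicit.
Unset Printing Implicit Defensive.

Import Order.TTheory GRing.Theory Num.Theory.
Local Open Scope classical_set_scope.
Local Open Scope ring_scope.

(* A finite simple graph on d vertices is a symmetric irreflexive relation on
   'I_d, the vertices 1, ..., d being renumbered 0, ..., d - 1. *)
Definition bipartite (V : finType) (e : rel V) : Prop :=
  exists side : V -> bool, forall i j, e i j -> side i != side j.

(* In a bipartite graph P(G) = [0,1]^d cut by the edge inequalities is a lattice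
   polytope, but with an isolated vertex its h*-polynomial is not palindromic of
   degree d - 2: h* = 1 + z for two isolated vertices (d = 2), and
   h* = 1 + 2z for one edge plus one isolated vertex (d = 3). *)
Definition no_isolated_vertex (V : finType) (e : rel V) : Prop :=
  forall i, exists j, e i j.

Definition graph_polytope (R : realType) (d : nat) (e : rel 'I_d) :
    set 'rV[R]_d :=
  [set x | (forall i, 0 <= x 0 i <= 1) /\
           (forall i j, e i j -> x 0 i + x 0 j <= 1)].

Definition dilate (R : realType) (d : nat) (t : nat) (P : set 'rV[R]_d) :
    set 'rV[R]_d :=
  [set t%:R *: x | x in P].

Definition lattice (R : realType) (d : nat) : set 'rV[R]_d :=
  [set x | forall i, x 0 i \is a Num.int].

(* fset_set is the empty finite set on infinite sets, so this is the number of
   lattice points of tP only for bounded P. *)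
Definition lattice_count (R : realType) (d : nat) (P : set 'rV[R]_d)
    (t : nat) : nat :=
  #|` fset_set (dilate t P `&` @lattice R d) |.

(* Formal power series are represented by their sequences of coefficients. *)
Definition ehrhart_series (R : realType) (d : nat) (P : set 'rV[R]_d) :
    nat -> R :=
  fun t => if t == 0%N then 1 else (lattice_count P t)%:R.

Definition series_mul (R : realType) (a b : nat -> R) : nat -> R :=
  fun n => \sum_(i < n.+1) a i * b (n - i)%N.

(* Ehr_P(z) = h(z) / (1 - z)^(d+1), with the denominator (which is invertible
   as a power series) cleared; h is determined by P through its coefficients. *)
Definition is_hstar (R : realType) (d : nat) (P : set 'rV[R]_d)
    (h : {poly R}) : Prop :=
  forall n, series_mul (ehrhart_series P) (fun k => ((1 - 'X) ^+ d.+1)`_k) n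
            = h`_n.

(* z^n p(1/z) = p(z) where n is the degree of p. As R is infinite, equality at
   all z != 0 is equality of polynomials. *)
Definition palindromic (R : realType) (p : {poly R}) : Prop :=
  forall z : R, z != 0 -> z ^+ (size p).-1 * p.[z^-1] = p.[z].

(* Main.v *)
Require Import Defs.
From mathcomp Require Import all_boot all_order all_algebra.
From mathcomp Require Import reals.
From mathcomp Require Import finmap boolp classical_sets cardinality zify.

(** Let the two colour classes of the bipartition be A (where [side] holds) and
B. Replacing [x_i] by [t - x_i] for i in A turns the edge inequalities
[x_i + x_j <= t] into [f j <= f i]; and since no vertex is isolated, [x_i <= t]
follows from the edge inequalities. So the lattice points of tP are the maps f
from the vertices to {0, ..., t} with [f j <= f i] for every edge from i in A to
j in B ([lattice_point_set]): the Ehrhart polynomial is the order polynomial of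
a poset of rank one.

The order polynomial is computed by Stanley's theory of (P, omega)-partitions.
Every map f sorts the vertices in decreasing order of its values, ties being
broken by a fixed injective weight w. If ties are broken compatibly with the
poset, f is order preserving exactly when the resulting list is a linear
extension of the poset ([card_respects]). The maps that are sorted by a given
list are weakly decreasing along it, strictly so at its non-ascents for w, and
the generating function of their number is z^k / (1 - z)^(d+1) with k the number
of non-ascents. Hence h is the sum of z^k over all linear extensions
([respects_series]).

The symmetry of h is an instance of Stanley reciprocity. If ties are broken in
the reverse order, the same construction counts the maps with the strict
inequalities [f j < f i]. It uses the same linear extensions, but a list with k
non-ascents for w has d - 1 - k non-ascents for the reversed weight, so the
numerator h' of the strict count satisfies h'_k = h_(d-1-k)
([coef_descent_poly_rev]). On the other hand subtracting 1 on A turns a strict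
map into {0, ..., t+1} into a weak map into {0, ..., t}, and this is a bijection
because every vertex lies on an edge ([strict_countS]). Hence h' = z h. The two
relations give h_(d-1) = h'_0 = 0 and h_(d-2-k) = h'_(k+1) = h_k, and
h_(d-2) = h_0 = 1. *)

Set Implicit Arguments.
Unset Strict Implicit.
Unset Printing Implicit Defensive.
Import Order.TTheory GRing.Theory Num.Theory.

(** * Sorting a map and linear extensions *)

(** The truth value [w i < w j] is added as a number: i comes before j when
[f j < f i], or when the values tie and w increases from i to j. This form lets
weak and strict inequalities be treated uniformly. *)
Definition precedes (T : finType) (w f : T -> nat) : rel T :=
  fun i j => f j < f i + (w i < w j).

Definition respects (T : finType) (w : T -> nat) (r : rel T) (f : T -> nat) :=
  [forall i, forall j, r i j ==> precedes w f i j].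

Lemma respectsP (T : finType) (w : T -> nat) (r : rel T) (f : T -> nat) :
  reflect (forall i j, r i j -> precedes w f i j) (respects w r f).
Proof.
apply: (iffP forallP) => rf i; last by apply/forallP => j; apply/implyP/rf.
by move=> j; apply/implyP; move: j; apply/forallP.
Qed.

Definition linear_extension (T : finType) (r : rel T) (s : seq T) :=
  uniq s && [forall i, forall j, r i j ==> (index i s < index j s)].

Lemma precedes_irr (T : finType) (w f : T -> nat) :
  irreflexive (precedes w f).
Proof. by move=> i; rewrite /precedes ltnn addn0 ltnn. Qed.

Lemma precedes_trans (T : finType) (w f : T -> nat) :
  transitive (precedes w f).
Proof. by move=> j i k; rewrite /precedes; lia. Qed.

(** A strict total order, because equal values are separated by [w]. *)
Lemma precedes_total (T : finType) (w f : T -> nat) (i j : T) :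
  injective w -> i != j -> ~~ precedes w f j i = precedes w f i j.
Proof.
move=> w_inj; rewrite -(inj_eq w_inj) /precedes; lia.
Qed.

Lemma uniq_tuple_full (T : finType) (s : #|T|.-tuple T) :
  uniq s -> forall i, i \in s.
Proof.
move=> us i; have /uniq_min_size : {subset s <= enum T} by move=> x; rewrite mem_enum.
by move=> /(_ us); rewrite size_tuple -cardT leqnn => -[] // _ ->; rewrite mem_enum.
Qed.

(** [s0] is the list of all elements sorted along the strict total order
[precedes w f]; a sorted list is determined by its elements. *)
Lemma sorting_tuple (T : finType) (w f : T -> nat) : injective w ->
  exists s0 : #|T|.-tuple T,
    forall s : #|T|.-tuple T,
      (uniq s && sorted (precedes w f) s) = (s == s0).
Proof.
move=> w_inj; pose le i j := ~~ precedes w f j i.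
have le_total : total le by move=> i j; rewrite /le /precedes; lia.
have le_trans : transitive le by move=> j i k; rewrite /le /precedes; lia.
have sz : size (sort le (enum T)) == #|T| by rewrite size_sort -cardT.
have us0 : uniq (sort le (enum T)) by rewrite sort_uniq enum_uniq.
have srt0 : sorted (precedes w f) (sort le (enum T)).
  rewrite (sorted_pairwise (@precedes_trans _ w f)).
  have := us0; rewrite uniq_pairwise => ne.
  have := sort_sorted le_total (enum T); rewrite (sorted_pairwise le_trans) => ple.
  apply: (@sub_pairwise _ [rel x y | (x != y) && le x y]); last by rewrite pairwise_relI ne.
  by move=> i j /= /andP[ij]; rewrite /le precedes_total.
exists (Tuple sz) => s; apply/andP/eqP => [[us ss]|->]; last by [].
apply/val_inj/(irr_sorted_eq (@precedes_trans _ w f) (@precedes_irr _ w f)) => //=.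
by move=> i; rewrite uniq_tuple_full // mem_sort mem_enum.
Qed.

(** In a list sorted along a strict total order, coming earlier in the list is
the same as being smaller for this order. *)
Lemma sorted_linear_extension (T : finType) (w f : T -> nat) (r : rel T)
    (s : #|T|.-tuple T) :
  uniq s -> sorted (precedes w f) s -> linear_extension r s = respects w r f.
Proof.
move=> us ss; rewrite /linear_extension us /=.
apply: eq_forallb => i; apply: eq_forallb => j; congr (_ ==> _).
have ms := uniq_tuple_full us.
have idx x y : index x s < index y s -> precedes w f x y.
  by apply: (sorted_ltn_index (@precedes_trans _ w f) ss).
apply/idP/idP => [|pij]; first exact: idx.
rewrite ltnNge leq_eqVlt; apply/negP => /orP[/eqP eqij|/idx pji].
  by move: pij; rewrite -(index_inj i (ms j) (ms i) eqij) precedes_irr.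
by have := precedes_trans pij pji; rewrite precedes_irr.
Qed.

(** The fundamental lemma of (P, omega)-partitions: each map is counted on the
right at the only list that sorts it. *)
Lemma card_respects (T : finType) (w : T -> nat) (r : rel T) (n : nat) :
  injective w ->
  #|[pred f : {ffun T -> 'I_n} | respects w r (val \o f)]| =
  \sum_(s : #|T|.-tuple T | linear_extension r s)
     #|[pred f : {ffun T -> 'I_n} | sorted (precedes w (val \o f)) s]|.
Proof.
move=> w_inj.
under eq_bigr => s _ do rewrite -sum1_card big_mkcond.
rewrite exchange_big -sum1_card big_mkcond /=; apply: eq_bigr => f _.
have [s0 s0P] := sorting_tuple (val \o f) w_inj.
have /andP[us0 ss0] : uniq s0 && sorted (precedes w (val \o f)) s0 by rewrite s0P.
rewrite -big_mkcondr (eq_bigl (fun s => (s == s0) && respects w r (val \o f))).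
  rewrite [in RHS]big_mkcondr big_pred1_eq; rewrite !inE; by case: ifP.
move=> s; rewrite inE -s0P; case: (boolP (uniq s)) => us.
  case: (boolP (sorted _ s)) => ss; last by rewrite andbF.
  by rewrite (sorted_linear_extension r us ss) andbT.
by rewrite /linear_extension (negbTE us).
Qed.

(** * Counting the maps sorted by a given list *)

(** The head is [true] because the first value is only bounded by t: the
constraint [x < t + true] is [x <= t]. *)
Definition ascents (T : finType) (w : T -> nat) (s : seq T) : seq bool :=
  if s is x :: s' then true :: pairmap (fun i j => w i < w j) x s' else [::].

(** The i-th entry of the mask tells whether the i-th value may equal the
previous one, the first value being compared with t. *)
Fixpoint chain_below (t : nat) (bs : seq bool) (c : seq nat) : bool :=
  match bs, c with
  | [::], [::] => true
  | b :: bs', x :: c' => (x < t + b) && chain_below x bs' c'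
  | _, _ => false
  end.

Fixpoint chain_count (bs : seq bool) (t : nat) : nat :=
  if bs is b :: bs' then \sum_(x < t + b) chain_count bs' x else 1.

Lemma path_chain_below (T : finType) (w f : T -> nat) (x : T) (s : seq T) :
  path (precedes w f) x s =
  chain_below (f x) (pairmap (fun i j => w i < w j) x s) (map f s).
Proof. by elim: s x => //= y s IH x; rewrite IH. Qed.

Lemma sorted_chain_below (T : finType) (w f : T -> nat) (t : nat) (s : seq T) :
  (forall i, f i <= t) ->
  sorted (precedes w f) s = chain_below t (ascents w s) (map f s).
Proof. by case: s => //= x s ft; rewrite path_chain_below addn1 ltnS ft. Qed.

Lemma card_tuple_cons (S : finType) (n : nat) (P : seq S -> bool) :
  #|[pred c : n.+1.-tuple S | P c]| =
  \sum_(x : S) #|[pred c : n.-tuple S | P (x :: c)]|.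
Proof.
under eq_bigr => x _ do rewrite -sum1_card.
rewrite pair_big_dep -sum1_card /=.
rewrite (reindex (fun p : S * n.-tuple S => [tuple of p.1 :: p.2])) //=.
exists (fun c : n.+1.-tuple S => (thead c, [tuple of behead c])).
  by move=> [x c] _ /=; congr pair; apply/val_inj.
by move=> c _ /=; rewrite -tuple_eta.
Qed.

(** The mask is read from the largest value down, so the count is obtained by
summing over the largest value. The bound [u <= t] makes the truncation to
'I_t.+1 harmless. *)
Lemma card_chain_below (n t u : nat) (bs : seq bool) :
  size bs = n -> u <= t ->
  #|[pred c : n.-tuple 'I_t.+1 | chain_below u bs (map val c)]| =
  chain_count bs u.
Proof.
elim: n u bs => [|n IH] u [|b bs] //= sbs ut.
  by rewrite (eq_card (B := {: 0.-tuple 'I_t.+1})) ?card_tuple // => c; rewrite !inE tuple0.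
case: sbs => sbs.
rewrite (card_tuple_cons _ (fun c => chain_below u (b :: bs) (map val c))) /=.
rewrite (big_ord_widen t.+1 (chain_count bs)); last by lia.
rewrite [RHS]big_mkcond; apply: eq_bigr => x _.
case: ifP => _; last by rewrite eq_card0.
by rewrite -IH // -ltnS.
Qed.

(** Reading the values of f along [s] is a bijection from maps to tuples, as [s]
lists every element once. *)
Lemma card_sorted_maps (T : finType) (w : T -> nat) (t : nat)
    (s : #|T|.-tuple T) : uniq s ->
  #|[pred f : {ffun T -> 'I_t.+1} | sorted (precedes w (val \o f)) s]| =
  chain_count (ascents w s) t.
Proof.
move=> us; rewrite -(@card_chain_below #|T| t) //; last first.
  rewrite -[in RHS](size_tuple s); case: (tval s) => //= x s'.
  by rewrite size_pairmap.
have ms := uniq_tuple_full us.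
have ltT i : index i s < #|T| by rewrite -{2}(size_tuple s) index_mem.
rewrite -sum1_card -[RHS]sum1_card.
rewrite [RHS](reindex (fun f : {ffun T -> 'I_t.+1} => map_tuple f s)) /=.
  apply: eq_bigl => f; rewrite !inE (@sorted_chain_below _ _ _ t) ?map_comp //.
  by move=> i; rewrite -ltnS /=.
exists (fun c => [ffun i => tnth c (Ordinal (ltT i))]).
  move=> f _; apply/ffunP => i; rewrite ffunE tnth_map (tnth_nth i) /=.
  by rewrite nth_index.
move=> c _; apply: eq_from_tnth => k; rewrite tnth_map ffunE; congr tnth.
by apply: val_inj; rewrite /= (tnth_nth (tnth s k)) index_uniq ?size_tuple.
Qed.

Local Open Scope ring_scope.

(** * Power series with denominator (1 - z)^m *)

(** On generating functions this is multiplication by 1 / (1 - z), so that the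
m-th iterate applied to the coefficients of p represents p(z) / (1 - z)^m. *)
Definition partial_sums (R : nmodType) (a : nat -> R) : nat -> R :=
  fun n => \sum_(i < n.+1) a i.

(** On generating functions this is multiplication by z. *)
Definition delay (R : nmodType) (a : nat -> R) : nat -> R :=
  fun n => if n is m.+1 then a m else 0.

Lemma partial_sums_inj (R : zmodType) : injective (@partial_sums R).
Proof.
move=> a b ab; apply/funext => -[|n].
  by have := congr1 (@^~ 0%N) ab; rewrite /partial_sums !big_ord1.
have := congr1 (@^~ n.+1) ab; rewrite /partial_sums big_ord_recr [RHS]big_ord_recr /=.
rewrite -/(partial_sums a n) -/(partial_sums b n) ab; exact: addrI.
Qed.

Lemma iter_partial_sums_inj (R : zmodType) (m : nat) :
  injective (iter m (@partial_sums R)).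
Proof. by elim: m => [|m IH] a b //= /partial_sums_inj /IH. Qed.

Lemma partial_sums_delay (R : nmodType) (a : nat -> R) :
  partial_sums (delay a) = delay (partial_sums a).
Proof.
apply/funext => -[|n]; rewrite /partial_sums /=; first by rewrite big_ord1.
by rewrite big_ord_recl add0r.
Qed.

Lemma iter_partial_sums_delay (R : nmodType) (m : nat) (a : nat -> R) :
  iter m (@partial_sums R) (delay a) = delay (iter m (@partial_sums R) a).
Proof. by elim: m => //= m ->; rewrite partial_sums_delay. Qed.

Lemma iter_partial_sums0 (R : nmodType) (m : nat) (a : nat -> R) :
  iter m (@partial_sums R) a 0%N = a 0%N.
Proof. by elim: m => //= m IH; rewrite /partial_sums big_ord1. Qed.

Lemma iter_partial_sums_sum (R : nmodType) (I : finType) (P : pred I)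
    (m : nat) (F : I -> nat -> R) (n : nat) :
  iter m (@partial_sums R) (fun k => \sum_(s | P s) F s k) n =
  \sum_(s | P s) iter m (@partial_sums R) (F s) n.
Proof.
elim: m n => //= m IH n; rewrite (funext IH) /partial_sums.
exact: exchange_big.
Qed.

Lemma coef_delay (R : nzRingType) (p : {poly R}) :
  delay (nth 0 p) = nth 0 (p * 'X).
Proof. by apply/funext => -[|n]; rewrite coefMX. Qed.

(** The n-th coefficient only involves the first n.+1 coefficients of the series,
so the series may be truncated to a polynomial p; the differences of partial
sums, which are the coefficients of p * (1 - z), give back the sequence. *)
Lemma series_mul_partial_sums (R : realType) (a : nat -> R) (q : {poly R})
    (n : nat) :
  series_mul (partial_sums a) (fun k => ((1 - 'X) * q)`_k) n =
  series_mul a (fun k => q`_k) n.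
Proof.
pose p := \poly_(i < n.+1) partial_sums a i.
transitivity ((p * ((1 - 'X) * q))`_n).
  by rewrite coefM; apply: eq_bigr => i _; rewrite coef_poly ltn_ord.
rewrite mulrA coefM; apply: eq_bigr => i _; congr (_ * _).
rewrite mulrBr mulr1 coefB coefMX !coef_poly ltn_ord.
case: i => -[|i] /= lt_i; first by rewrite subr0 /partial_sums big_ord1.
by rewrite (ltnW lt_i) /partial_sums big_ord_recr addrAC subrr add0r.
Qed.

Lemma series_mul_iter_partial_sums (R : realType) (a : nat -> R) (m n : nat) :
  series_mul (iter m (@partial_sums R) a) (fun k => ((1 - 'X) ^+ m)`_k) n = a n.
Proof.
elim: m => [|m IH] /=; last by under eq_fun do rewrite exprS; rewrite series_mul_partial_sums.
rewrite /series_mul expr0 big_ord_recr /= subnn coef1 mulr1 big1 ?add0r // => i _.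
by rewrite coef1 subn_eq0 leqNgt ltn_ord mulr0.
Qed.

(** * The numerator as a sum over linear extensions *)

Definition nonascents (T : finType) (w : T -> nat) (s : seq T) : nat :=
  count negb (ascents w s).

Definition descent_poly (R : nzRingType) (T : finType) (w : T -> nat)
    (r : rel T) : {poly R} :=
  \sum_(s : #|T|.-tuple T | linear_extension r s) 'X^(nonascents w s).

(** A weak step replaces the count by its partial sums; a strict step moreover
shifts them by one, which contributes a factor z. *)
Lemma chain_count_series (R : nzRingType) (bs : seq bool) :
  (fun t => (chain_count bs t)%:R) =
  iter (size bs).+1 (@partial_sums R) (nth 0 'X^(count negb bs)).
Proof.
elim: bs => [|b bs IH].
  apply/funext => t /=; rewrite /partial_sums big_ord_recl expr0 coef1 big1 ?addr0 // => i _.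
  by rewrite coef1.
have sumE t : partial_sums (fun t => (chain_count bs t)%:R) t =
    (\sum_(x < t.+1) chain_count bs x)%:R :> R by rewrite natr_sum.
rewrite [size _]/= iterS; case: b => /=; rewrite ?add0n ?add1n.
  by rewrite -iterS -IH; apply/funext => t; rewrite sumE addn1.
rewrite exprSr -coef_delay -iterS iter_partial_sums_delay partial_sums_delay.
rewrite -IH; apply/funext => -[|t]; rewrite addn0; first by rewrite big_ord0.
by rewrite /delay sumE.
Qed.

Lemma size_ascents (T : finType) (w : T -> nat) (s : seq T) :
  size (ascents w s) = size s.
Proof. by case: s => //= x s; rewrite size_pairmap. Qed.

Lemma respects_series (R : nzRingType) (T : finType) (w : T -> nat) (r : rel T) :
  injective w ->
  (fun t => #|[pred f : {ffun T -> 'I_t.+1} | respects w r (val \o f)]|%:R) =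
  iter #|T|.+1 (@partial_sums R) (nth 0 (descent_poly R w r)).
Proof.
move=> w_inj; apply/funext => t; rewrite card_respects // natr_sum.
have -> : nth 0 (descent_poly R w r) = fun k =>
    \sum_(s : #|T|.-tuple T | linear_extension r s) ('X^(nonascents w s))`_k.
  by apply/funext => k; rewrite coef_sum.
rewrite iter_partial_sums_sum; apply: eq_bigr => s /andP[us _].
rewrite card_sorted_maps // -[LHS]/((fun t => (chain_count (ascents w s) t)%:R) t).
by rewrite chain_count_series size_ascents size_tuple.
Qed.

(** Each of the [size s - 1] consecutive pairs is an ascent for exactly one of the
two weights; the head of the mask is an ascent for both. *)
Lemma nonascents_rev (T : finType) (w w' : T -> nat) (s : seq T) :
  (forall i j, i != j -> (w' i < w' j)%N = ~~ (w i < w j)%N) -> uniq s ->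
  (nonascents w' s + nonascents w s)%N = (size s).-1.
Proof.
move=> rev_w; rewrite /nonascents; case: s => //= x s; rewrite !add0n.
elim: s x => //= y s IH x /andP[]; rewrite inE negb_or => /andP[xy _] us.
by rewrite -(IH y) // rev_w // negbK; case: (w x < w y)%N; lia.
Qed.

Lemma coef_descent_poly_rev (R : nzRingType) (T : finType) (w w' : T -> nat)
    (r : rel T) (k : nat) :
  (forall i j, i != j -> (w' i < w' j)%N = ~~ (w i < w j)%N) ->
  (k <= #|T|.-1)%N ->
  (descent_poly R w' r)`_k = (descent_poly R w r)`_(#|T|.-1 - k).
Proof.
move=> rev_w kT; rewrite !coef_sum; apply: eq_bigr => s /andP[us _].
have := nonascents_rev rev_w us; rewrite size_tuple !coefXn => sumT.
by congr (nat_of_bool _)%:R; lia.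
Qed.

Lemma size_descent_poly (R : nzRingType) (T : finType) (w : T -> nat)
    (r : rel T) :
  (0 < #|T|)%N -> (size (descent_poly R w r) <= #|T|)%N.
Proof.
move=> T0; apply/leq_sizeP => k Tk; rewrite coef_sum big1 // => s _.
rewrite coefXn; case: eqP => // ks; suff : (nonascents w s < #|T|)%N by lia.
move: T0; rewrite /nonascents; case: (tval s) (size_tuple s) => [|x s'] /= <- // _.
by rewrite ltnS (leq_trans (count_size _ _)) // size_pairmap.
Qed.

(** * The poset of a bipartite graph *)

Definition oriented (d : nat) (e : rel 'I_d) (side : 'I_d -> bool) : rel 'I_d :=
  fun i j => [&& e i j, side i & ~~ side j].

(** Ties put the colour class [side] first, hence are allowed along the oriented
edges: this is a natural labelling of the poset. *)
Definition natural_weight (d : nat) (side : 'I_d -> bool) (i : 'I_d) : nat :=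
  if side i then i : nat else (d + i)%N.

(** The reversed order of the vertices, for which ties along the oriented edges
are forbidden. *)
Definition strict_weight (d : nat) (side : 'I_d -> bool) (i : 'I_d) : nat :=
  (2 * d - natural_weight side i)%N.

Lemma natural_weight_inj (d : nat) (side : 'I_d -> bool) :
  injective (natural_weight side).
Proof.
move=> i j; rewrite /natural_weight => ij; apply: val_inj => /=; move: ij.
by have := ltn_ord i; have := ltn_ord j; do 2!case: ifP => _; lia.
Qed.

Lemma natural_weight_lt (d : nat) (side : 'I_d -> bool) (i : 'I_d) :
  (natural_weight side i < 2 * d)%N.
Proof. by rewrite /natural_weight; have := ltn_ord i; case: ifP => _; lia. Qed.

Lemma strict_weight_inj (d : nat) (side : 'I_d -> bool) :
  injective (strict_weight side).
Proof.
move=> i j; rewrite /strict_weight => ij; apply: (@natural_weight_inj _ side).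
by have := natural_weight_lt side i; have := natural_weight_lt side j; lia.
Qed.

Lemma strict_weight_rev (d : nat) (side : 'I_d -> bool) (i j : 'I_d) :
  i != j -> (strict_weight side i < strict_weight side j)%N =
            ~~ (natural_weight side i < natural_weight side j)%N.
Proof.
rewrite -(inj_eq (@natural_weight_inj _ side)) /strict_weight.
by have := natural_weight_lt side i; have := natural_weight_lt side j; lia.
Qed.

Lemma respects_natural (d : nat) (e : rel 'I_d) (side : 'I_d -> bool)
    (f : 'I_d -> nat) :
  respects (natural_weight side) (oriented e side) f <->
  forall i j, oriented e side i j -> (f j <= f i)%N.
Proof.
have precE i j : oriented e side i j ->
    precedes (natural_weight side) f i j = (f j <= f i)%N.
  move=> /and3P[_ si sj]; rewrite /precedes /natural_weight si (negbTE sj).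
  by have := ltn_ord i; lia.
by split=> [/respectsP|] rf; [|apply/respectsP] => i j rij;
   have := rf i j rij; rewrite precE.
Qed.

Lemma respects_strict (d : nat) (e : rel 'I_d) (side : 'I_d -> bool)
    (f : 'I_d -> nat) :
  respects (strict_weight side) (oriented e side) f <->
  forall i j, oriented e side i j -> (f j < f i)%N.
Proof.
have precE i j : oriented e side i j ->
    precedes (strict_weight side) f i j = (f j < f i)%N.
  move=> /and3P[_ si sj]; rewrite /precedes /strict_weight /natural_weight.
  by rewrite si (negbTE sj); have := ltn_ord i; lia.
by split=> [/respectsP|] rf; [|apply/respectsP] => i j rij;
   have := rf i j rij; rewrite precE.
Qed.

Definition weak_count (d : nat) (e : rel 'I_d) (side : 'I_d -> bool) (t : nat) :=
  #|[pred f : {ffun 'I_d -> 'I_t.+1} |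
     respects (natural_weight side) (oriented e side) (val \o f)]|.

Definition strict_count (d : nat) (e : rel 'I_d) (side : 'I_d -> bool) (t : nat) :=
  #|[pred f : {ffun 'I_d -> 'I_t.+1} |
     respects (strict_weight side) (oriented e side) (val \o f)]|.

Lemma oriented_neighbour (d : nat) (e : rel 'I_d) (side : 'I_d -> bool)
    (i : 'I_d) :
  symmetric e -> (forall i j, e i j -> side i != side j) ->
  no_isolated_vertex e ->
  exists j, if side i then oriented e side i j else oriented e side j i.
Proof.
move=> e_sym e_side e_noiso; have [j eij] := e_noiso i; exists j.
have := e_side i j eij; rewrite /oriented [e j i]e_sym eij.
by case: (side i); case: (side j).
Qed.

(** Subtracting 1 on the colour class [side] turns strict inequalities into weak
ones. The new values fit in {0, ..., t}: a vertex of [side] has a value at least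
1 and a vertex off [side] a value at most t, because each has a neighbour whose
value is strictly smaller, respectively larger. *)
Lemma strict_countS (d : nat) (e : rel 'I_d) (side : 'I_d -> bool) (t : nat) :
  symmetric e -> (forall i j, e i j -> side i != side j) ->
  no_isolated_vertex e ->
  strict_count e side t.+1 = weak_count e side t.
Proof.
move=> e_sym e_side e_noiso; rewrite /strict_count /weak_count.
pose up (g : {ffun 'I_d -> 'I_t.+1}) : {ffun 'I_d -> 'I_t.+2} :=
  [ffun i => inord (g i + side i)].
pose down (f : {ffun 'I_d -> 'I_t.+2}) : {ffun 'I_d -> 'I_t.+1} :=
  [ffun i => inord (f i - side i)].
have upE g i : up g i = (g i + side i)%N :> nat.
  by rewrite ffunE inordK //; have := ltn_ord (g i); case: (side i); lia.
rewrite -sum1_card -[RHS]sum1_card (reindex_onto up down) => [|f] /=.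
  apply: eq_bigl => g; rewrite !inE.
  have -> : down (up g) = g.
    by apply/ffunP => i; apply: val_inj; rewrite ffunE upE addnK inord_val.
  rewrite eqxx andbT; apply/idP/idP => [/respects_strict gP|/respects_natural gP].
    apply/respects_natural => i j rij; have := gP i j rij; rewrite /= !upE.
    by have /and3P[_ -> /negbTE->] := rij; lia.
  apply/respects_strict => i j rij; rewrite /= !upE; have := gP i j rij => /=.
  by have /and3P[_ -> /negbTE->] := rij; lia.
rewrite inE => /respects_strict fP; apply/ffunP => i; apply: val_inj.
rewrite /= upE ffunE /=; have := ltn_ord (f i).
have [j] := oriented_neighbour i e_sym e_side e_noiso.
case: (side i) => /fP /= fij lt_f; rewrite inordK; try by lia.
by rewrite subn0 (leq_trans fij) // -ltnS ltn_ord.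
Qed.

Lemma strict_count0 (d : nat) (e : rel 'I_d) (side : 'I_d -> bool) :
  (0 < d)%N -> symmetric e -> (forall i j, e i j -> side i != side j) ->
  no_isolated_vertex e -> strict_count e side 0 = 0%N.
Proof.
move=> d_gt0 e_sym e_side e_noiso; apply: eq_card0 => f; rewrite inE.
apply/negbTE/negP => /respects_strict fP.
have [j] := oriented_neighbour (Ordinal d_gt0) e_sym e_side e_noiso.
by case: ifP => _ /fP /=; rewrite !ord1.
Qed.

Lemma weak_count0 (d : nat) (e : rel 'I_d) (side : 'I_d -> bool) :
  weak_count e side 0 = 1%N.
Proof.
rewrite /weak_count (eq_card (B := {: {ffun 'I_d -> 'I_1}})).
  by rewrite card_ffun card_ord exp1n.
by move=> f; rewrite !inE; apply/respects_natural => i j _ /=; rewrite !ord1.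
Qed.

(** * Lattice points of the dilated polytope *)

(** Flipping the coordinates on one colour class turns the order relations
between values into the edge inequalities. *)
Definition lattice_point (R : realType) (d : nat) (side : 'I_d -> bool)
    (t : nat) (f : {ffun 'I_d -> 'I_t.+1}) : 'rV[R]_d :=
  \row_i (if side i then t - f i else f i : nat)%N%:R.

Lemma lattice_point_inj (R : realType) (d : nat) (side : 'I_d -> bool) (t : nat) :
  injective (@lattice_point R d side t).
Proof.
move=> f g /rowP fg; apply/ffunP => i; apply: val_inj.
have := fg i; rewrite !mxE => /eqP; rewrite eqr_nat => /eqP.
by have := ltn_ord (f i); have := ltn_ord (g i); case: ifP => _ /=; lia.
Qed.

Lemma lattice_point_set (R : realType) (d : nat) (e : rel 'I_d)
    (side : 'I_d -> bool) (t : nat) :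
  symmetric e -> (forall i j, e i j -> side i != side j) -> (0 < t)%N ->
  (dilate t (@graph_polytope R d e) `&` @lattice R d =
  [set` [fset lattice_point R side f | f in
     [pred f : {ffun 'I_d -> 'I_t.+1} |
      respects (natural_weight side) (oriented e side) (val \o f)]]%fset])%classic.
Proof.
move=> e_sym e_side t_gt0; have tR : (0 : R) < t%:R by rewrite ltr0n.
apply/seteqP; split => [_ [[x [x01 xe] <-] xint]|_ /imfsetP[f /= fP ->]].
  (* An integral coordinate of t x lies in {0, ..., t}. *)
  have m_ex i : exists m : 'I_t.+1, (t%:R *: x) 0 i = m%:R.
    have /andP[x0 x1] := x01 i.
    have /natrP[m mE] : (t%:R *: x) 0 i \is a Num.nat.
      by rewrite natrEint xint mxE mulr_ge0 ?ler0n.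
    have mt : (m < t.+1)%N.
      by rewrite ltnS -(ler_nat R) -mE mxE ler_piMr ?ler0n.
    by exists (Ordinal mt).
  have [m mE] := choice m_ex.
  apply/imfsetP; exists [ffun i => inord (if side i then t - m i else m i)%N] => /=.
    apply/respects_natural => i j /and3P[eij si sj] /=.
    rewrite !ffunE si (negbTE sj) !inordK ?ltnS ?leq_subr //; last by rewrite -ltnS.
    suff : (m i + m j <= t)%N by lia.
    rewrite -(ler_nat R) natrD -!mE !mxE -mulrDr ler_piMr ?ler0n //.
    exact: xe.
  apply/rowP => i; rewrite mE !mxE ffunE; congr _%:R.
  have mi : (m i <= t)%N by rewrite -ltnS ltn_ord.
  by case: (side i); rewrite inordK ?subKn ?ltnS ?leq_subr.
have valE i : lattice_point R side f 0 i <= t%:R /\ 0 <= lattice_point R side f 0 i.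
  rewrite mxE ler0n ler_nat; have := ltn_ord (f i).
  by case: ifP => _; split=> //; lia.
split; last by move=> i; rewrite mxE; apply: intr_nat; rewrite natr_nat.
exists (t%:R^-1 *: lattice_point R side f); last first.
  by rewrite scalerA divff ?scale1r // gt_eqF.
have scaleE i : (t%:R^-1 *: lattice_point R side f) 0 i =
    t%:R^-1 * lattice_point R side f 0 i by rewrite mxE.
split=> [i|i j eij]; rewrite !scaleE.
  have [le_t ge_0] := valE i.
  by rewrite mulr_ge0 ?invr_ge0 ?ler0n //= mulrC ler_pdivrMr // mul1r.
move/respects_natural: fP => fP.
rewrite -mulrDr mulrC ler_pdivrMr // mul1r 2!mxE -natrD ler_nat.
have := e_side i j eij; case si: (side i); case sj: (side j) => // _.
  have /fP /= le_ji : oriented e side i j by rewrite /oriented eij si sj.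
  by rewrite (leq_trans (_ : _ <= t - f i + f i)%N) ?leq_add2l // subnK // -ltnS.
have /fP /= le_ij : oriented e side j i by rewrite /oriented e_sym eij si sj.
by rewrite (leq_trans (_ : _ <= f j + (t - f j))%N) ?leq_add2r // subnKC // -ltnS.
Qed.

Lemma ehrhart_weak_count (R : realType) (d : nat) (e : rel 'I_d)
    (side : 'I_d -> bool) :
  symmetric e -> (forall i j, e i j -> side i != side j) ->
  ehrhart_series (@graph_polytope R d e) = fun t => (weak_count e side t)%:R.
Proof.
move=> e_sym e_side; apply/funext => -[|t]; rewrite /ehrhart_series /=.
  by rewrite weak_count0.
rewrite /lattice_count (lattice_point_set R e_sym e_side) // set_fsetK.
rewrite card_imfset; last exact: lattice_point_inj.
by rewrite /weak_count cardE.
Qed.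

(** * The numerator is palindromic of degree d - 2 *)

Theorem theorem5 (R : realType) (d : nat) (e : rel 'I_d)
  (d_gt0 : (0 < d)%N)
  (e_sym : symmetric e) (e_irr : irreflexive e)
  (e_bip : bipartite e) (e_noiso : no_isolated_vertex e) :
  exists h : {poly R},
    [/\ is_hstar (@graph_polytope R d e) h,
        size h = (d - 2).+1 &
        palindromic h].
Proof.
have [side e_side] := e_bip.
pose h := descent_poly R (natural_weight side) (oriented e side).
pose h' := descent_poly R (strict_weight side) (oriented e side).
have weakE := respects_series R (oriented e side) (@natural_weight_inj _ side).
have strictE := respects_series R (oriented e side) (@strict_weight_inj _ side).
rewrite -/h card_ord in weakE; rewrite -/h' card_ord in strictE.
have d_gt1 : (1 < d)%N.
  have [j eij] := e_noiso (Ordinal d_gt0).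
  have : j != Ordinal d_gt0 by apply: contraNneq (e_side _ _ eij) => ->.
  by rewrite -val_eqE /=; have := ltn_ord j; lia.
(* The strict count at t.+1 is the weak count at t, and vanishes at 0. *)
have h'E : h' = h * 'X.
  apply/polyP => k; congr (_ k); apply: (@iter_partial_sums_inj R d.+1).
  rewrite -coef_delay iter_partial_sums_delay -weakE -strictE.
  apply/funext => -[|t] /=.
    by rewrite -/(strict_count e side 0) strict_count0.
  by rewrite -/(strict_count e side t.+1) strict_countS.
(* Reciprocity: the reversed weight reverses the coefficients. *)
have h_rev k : (k < d)%N -> (h * 'X)`_k = h`_(d.-1 - k).
  move=> kd; rewrite -h'E /h' /h.
  by rewrite (coef_descent_poly_rev _ _ (@strict_weight_rev _ side)) card_ord //; lia.
have h_top k : (d.-1 <= k)%N -> h`_k = 0.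
  rewrite leq_eqVlt => /orP[/eqP <-|dk].
    by rewrite -[d.-1]subn0 -h_rev // coefMX.
  have := size_descent_poly R (natural_weight side) (oriented e side).
  by rewrite card_ord => /(_ d_gt0) /leq_sizeP; apply; lia.
have h0 : h`_0 = 1.
  by rewrite -(iter_partial_sums0 d.+1 (nth 0 h)) -weakE -/(weak_count e side 0) weak_count0.
have h_sym k : (k <= d - 2)%N -> h`_(d - 2 - k) = h`_k.
  move=> kd; have := h_rev k.+1; rewrite coefMX /= => ->; last by lia.
  by congr (h`_ _); lia.
have sz_h : size h = (d - 2).+1.
  apply/eqP; rewrite eqn_leq; apply/andP; split.
    by apply/leq_sizeP => k dk; apply: h_top; lia.
  rewrite ltnNge; apply/negP => /leq_sizeP/(_ _ (leqnn _)) /eqP.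
  by rewrite -[X in h`_X]subn0 h_sym // h0 oner_eq0.
exists h; split=> //.
  move=> n; rewrite (ehrhart_weak_count R e_sym e_side) /weak_count weakE.
  exact: series_mul_iter_partial_sums.
move=> z z0; rewrite !horner_coef sz_h /= mulr_sumr (reindex_inj rev_ord_inj) /=.
apply: eq_bigr => i _; rewrite subSS.
have id2 : (i <= d - 2)%N by rewrite -ltnS.
rewrite h_sym // mulrCA; congr (_ * _).
by rewrite exprVn -expfB_cond ?(negbTE z0) ?leq_subr // subKn.
Qed.
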